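(* Let $\mathcal{O}$ be the class of outerplanar graphs. For every integer $\ell > 0$ there exists a graph $G = G(\ell)$ such that $e_{\mathcal{O}}(G)=1$ and $\eta_{\mathcal{O}}(G) \geq \ell$.
   Context: All graphs are finite and simple. A graph is outerplanar if it can be drawn in the plane without edge crossings such that some face is incident with all vertices (equivalently, it has no topological minor isomorphic to $K_4$ or $K_{2,3}$). For a class $\mathcal{C}$ of graphs closed under isomorphisms and subgraphs and a graph $G$: - $e_{\mathcal{C}}(G)$ (edit distance) is the minimum of $|E(G')\triangle E(G)|$ over all $G'\in\mathcal{C}$ with $V(G')=V(G)$; equivalently, the minimum number of edges whose deletion from $G$ gives a graph in $\mathcal{C}$. - $\eta_{\mathcal{C}}(G)$ ($\mathcal{C}$-edge-brittleness) is the minimum $m$ such that there is a partition $(V_1,\dots,V_n)$ of $V(G)$ with the induced subgraph $G[V_i]\in\mathcal{C}$ for all $i$ and exactly $m$ edges of $G$ having ends in distinct $V_i$'s. *)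

(* Defs.v *)
From mathcomp Require Import all_boot.

Set Implicit Arguments.
Unset Strict Implicit.
Unset Printing Implicit Defensive.

(* A finite simple graph with vertex set V. *)
Record sgraph (V : finType) := SGraph {
  adj :> rel V;
  adj_sym : symmetric adj;
  adj_irrefl : irreflexive adj
}.

Definition graph_class := forall V : finType, sgraph V -> Prop.

Definition edges (V : finType) (G : sgraph V) : {set {set V}} :=
  [set [set uv.1; uv.2] | uv : V * V & G uv.1 uv.2].

Section Induced.
Variables (V : finType) (G : sgraph V) (A : {set V}).
Let induced_adj : rel {x : V | x \in A} := [rel x y | G (val x) (val y)].

Fact induced_sym : symmetric induced_adj.
Proof. by move=> x y; exact: adj_sym. Qed.

Fact induced_irrefl : irreflexive induced_adj.
Proof. by move=> x; exact: adj_irrefl. Qed.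

Definition induced := SGraph induced_sym induced_irrefl.
End Induced.

Section Complete.
Variable n : nat.
Let complete_adj : rel 'I_n := [rel x y | x != y].

Fact complete_sym : symmetric complete_adj.
Proof. by move=> x y; rewrite /complete_adj /= eq_sym. Qed.

Fact complete_irrefl : irreflexive complete_adj.
Proof. by move=> x; rewrite /complete_adj /= eqxx. Qed.

Definition complete := SGraph complete_sym complete_irrefl.
End Complete.

Section CompleteBipartite.
Variables m n : nat.
Let bipartite_adj : rel ('I_m + 'I_n) :=
  fun x y => match x, y with
             | inl _, inr _ | inr _, inl _ => true
             | _, _ => false
             end.

Fact bipartite_sym : symmetric bipartite_adj.
Proof. by case=> x; case. Qed.

Fact bipartite_irrefl : irreflexive bipartite_adj.
Proof. by case. Qed.

Definition complete_bipartite := SGraph bipartite_sym bipartite_irrefl.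
End CompleteBipartite.

(* G contains a subdivision of H as a subgraph: f gives the branch vertices,
   and p x y lists the inner vertices, in order, of the path of G from f x to
   f y that replaces the edge xy of H. *)
Definition topological_minor (W V : finType) (H : sgraph W) (G : sgraph V) :=
  exists (f : W -> V) (p : W -> W -> seq V),
    [/\ injective f,
        forall x y, H x y ->
          path G (f x) (rcons (p x y) (f y)) /\ uniq (p x y),
        forall x y, H x y -> p y x = rev (p x y),
        forall x y z, H x y -> f z \notin p x y
      & forall x y x' y' v, H x y -> H x' y' ->
          v \in p x y -> v \in p x' y' -> [set x; y] = [set x'; y']].

(* Plane drawings are not available in the library; the definition is in terms
   of the forbidden topological minors of outerplanar graphs. *)
Definition outerplanar : graph_class := fun V G =>
  ~ topological_minor (complete 4) G /\
  ~ topological_minor (complete_bipartite 2 3) G.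

Definition is_minimum (P : nat -> Prop) (m : nat) :=
  P m /\ forall k, P k -> m <= k.

(* edit_distance C G m means e_C(G) = m. *)
Definition edit_distance (C : graph_class) (V : finType) (G : sgraph V) :=
  is_minimum (fun m => exists G' : sgraph V, C V G' /\
    m = #|(edges G' :\: edges G) :|: (edges G :\: edges G')|).

Definition cross_edges (V : finType) (G : sgraph V) (P : {set {set V}}) :
    {set {set V}} :=
  [set [set uv.1; uv.2] | uv : V * V &
    G uv.1 uv.2 && (pblock P uv.1 != pblock P uv.2)].

(* edge_brittleness C G m means eta_C(G) = m. *)
Definition edge_brittleness (C : graph_class) (V : finType) (G : sgraph V) :=
  is_minimum (fun m => exists P : {set {set V}},
    [/\ partition P [set: V],
        forall A, A \in P -> C _ (induced G A)
      & m = #|cross_edges G P|]).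

(* Main.v *)
Require Import Defs.
From mathcomp Require Import all_boot zify.
From Stdlib Require Import Classical.

Set Implicit Arguments.
Unset Strict Implicit.
Unset Printing Implicit Defensive.

(** Put the vertices 0, ..., 4M with M = 2^l on a line and join two of them
    when they are consecutive multiples of a power of 2. These arcs do not
    cross, so the graph is outerplanar; adding the edge {M, 4M} creates a K4 on
    0, M, 2M, 4M. If a partition separates two of these four vertices, it
    separates two consecutive multiples of M, hence, by repeated halving, two
    consecutive multiples of 2^j for every j <= l: at least l + 1 edges of
    distinct lengths are cut. Otherwise one part contains the K4. *)

(** * Noncrossing placements of a graph on a line *)

Definition between (a b c : nat) := (a < c < b) || (b < c < a).

(** With [h] as position on a line and edges as arcs in one half-plane, vertex-disjoint edges do not
    interleave: a one-page book embedding when [h] is injective. *)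
Definition noncrossing (V : finType) (G : sgraph V) (h : V -> nat) :=
  forall x y u v, G x y -> G u v -> u \notin [:: x; y] -> v \notin [:: x; y] ->
    between (h x) (h y) (h u) = between (h x) (h y) (h v).

Section Noncrossing.
Variables (V : finType) (G : sgraph V) (h : V -> nat).
Hypotheses (h_inj : injective h) (ncG : noncrossing G h).

(** Each edge of the path is disjoint from [xy], so no single step can enter or leave the interval
    below that arc. *)
Lemma between_path x y u s : G x y -> path G u s ->
  x \notin u :: s -> y \notin u :: s ->
  between (h x) (h y) (h u) = between (h x) (h y) (h (last u s)).
Proof.
move=> xy; elim: s u => [|v s IHs] u //.
rewrite [path _ _ _]/= => /andP[uv vs].
rewrite in_cons negb_or => /andP[xu xs]; rewrite in_cons negb_or => /andP[yu ys].
rewrite /= -(IHs v) //; apply: (ncG xy uv).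
  by rewrite !inE negb_or ![u == _]eq_sym xu.
move: xs ys; rewrite !inE !negb_or => /andP[xv _] /andP[yv _].
by rewrite ![v == _]eq_sym xv.
Qed.

(** By [between_path], each edge of the first path has both ends of the second path on the same
    side. For distinct positions this relation is symmetric in the two pairs, so no step of the
    first path crosses the interval from [u] to [last u t]. *)
Lemma disjoint_paths_between x s u t : path G x s -> path G u t ->
  ~~ has [in u :: t] (x :: s) ->
  between (h u) (h (last u t)) (h x) =
  between (h u) (h (last u t)) (h (last x s)).
Proof.
move=> + ut; elim: s x => [|y s IHs] x //.
rewrite [path _ _ _]/= => /andP[xy ys].
rewrite [has _ _]/= negb_or => /andP[xut dis].
rewrite -IHs //; move: dis; rewrite /= negb_or => /andP[yut _].
have := between_path xy ut xut yut.
have neq z w : z \notin u :: t -> w \in u :: t -> h z <> h w.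
  by move=> zut wut /h_inj zw; rewrite zw wut in zut.
have := neq _ _ xut (mem_head u t); have := neq _ _ yut (mem_head u t).
have := neq _ _ xut (mem_last u t); have := neq _ _ yut (mem_last u t).
rewrite /between; move: (h x) (h y) (h u) (h (last u t)) => a b c d; lia.
Qed.

(** Placing each vertex of [H] at its branch vertex works, since disjoint edges of [H] become
    disjoint paths of [G]. *)
Lemma topological_minor_between (W : finType) (H : sgraph W) :
  topological_minor H G -> exists2 g : W -> nat, injective g &
  forall x y u v, H x y -> H u v -> u \notin [:: x; y] -> v \notin [:: x; y] ->
    between (g u) (g v) (g x) = between (g u) (g v) (g y).
Proof.
move=> [f [p [f_inj path_p _ fp pp]]].
exists (h \o f) => [|x y u v xy uv ux vx /=]; first exact: inj_comp.
have [pxy _] := path_p _ _ xy; have [puv _] := path_p _ _ uv.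
have xuv z : z \in [:: x; y] -> z \notin [:: u; v].
  rewrite !inE => zx; rewrite negb_or; apply/andP; split.
    by apply: contra ux => /eqP <-; rewrite !inE.
  by apply: contra vx => /eqP <-; rewrite !inE.
have := disjoint_paths_between pxy puv; rewrite !last_rcons; apply.
have endpoint z : z \in [:: x; y] -> f z \notin f u :: rcons (p u v) (f v).
  move=> /xuv zuv; rewrite in_cons mem_rcons in_cons !(inj_eq f_inj).
  by move: zuv; rewrite !inE !negb_or => /andP[-> ->]; apply: fp.
apply/hasPn => z; rewrite in_cons mem_rcons in_cons.
case/or3P=> [/eqP->|/eqP->|zp]; try by rewrite endpoint // !inE eqxx ?orbT.
rewrite /= in_cons mem_rcons in_cons !negb_or.
apply/and3P; split.
- by apply/eqP => zf; move: (fp _ _ u xy); rewrite -zf zp.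
- by apply/eqP => zf; move: (fp _ _ v xy); rewrite -zf zp.
- apply/negP => zq; have /setP/(_ u) := pp _ _ _ _ _ xy uv zp zq.
  by move: ux; rewrite !inE eqxx /= => /negbTE->.
Qed.

Lemma noncrossing_outerplanar : outerplanar G.
Proof.
split=> /topological_minor_between[g g_inj sep].
  pose i k : 'I_4 := inord k.
  have i_neq a b : a < 4 -> b < 4 -> a != b -> i a != i b.
    by move=> a4 b4; rewrite -val_eqE /= !inordK.
  have g_neq a b : a < 4 -> b < 4 -> a != b -> g (i a) <> g (i b).
    by move=> a4 b4 ab /g_inj /eqP; apply/negP/i_neq.
  have S a b c d : a < 4 -> b < 4 -> c < 4 -> d < 4 -> uniq [:: a; b; c; d] ->
      between (g (i c)) (g (i d)) (g (i a)) =
      between (g (i c)) (g (i d)) (g (i b)).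
    move=> a4 b4 c4 d4; rewrite /= !inE !negb_or !andbT -!andbA.
    case/and5P=> ab ac ad bc /andP[bd cd].
    by apply: sep; rewrite ?inE ?negb_or /= ?i_neq // eq_sym.
  (* One of the three pairings of four points on a line is crossing. *)
  have := S 0 1 2 3 isT isT isT isT isT; have := S 0 2 1 3 isT isT isT isT isT.
  have := S 0 3 1 2 isT isT isT isT isT.
  have := g_neq 0 1 isT isT isT; have := g_neq 0 2 isT isT isT.
  have := g_neq 0 3 isT isT isT; have := g_neq 1 2 isT isT isT.
  have := g_neq 1 3 isT isT isT; have := g_neq 2 3 isT isT isT.
  rewrite /between.
  move: (g (i 0)) (g (i 1)) (g (i 2)) (g (i 3)) => a b c d; lia.
pose a : 'I_2 + 'I_3 := inl ord0; pose b : 'I_2 + 'I_3 := inl ord_max.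
pose c k : 'I_2 + 'I_3 := inr (inord k).
have c_neq j k : j < 3 -> k < 3 -> j != k -> c j != c k.
  move=> j3 k3; apply: contra => /eqP[] /(congr1 val).
  by rewrite /= !inordK // => ->.
have S j k : j < 3 -> k < 3 -> j != k ->
    between (g b) (g (c k)) (g a) = between (g b) (g (c k)) (g (c j)).
  move=> j3 k3 jk; apply: sep => //; rewrite !inE negb_or //=.
  by rewrite c_neq // eq_sym.
have gc j k : j < 3 -> k < 3 -> j != k -> g (c j) <> g (c k).
  by move=> j3 k3 jk /g_inj /eqP; apply/negP/c_neq.
have gab : g a <> g b by move/g_inj.
have gac k : g a <> g (c k) by move/g_inj.
have gbc k : g b <> g (c k) by move/g_inj.
(* Vertices [c j], [c k] on the same side of [a], [b] would make the paths
   a - c k and b - c j, or a - c j and b - c k, cross. *)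
have side j k : j < 3 -> k < 3 -> j != k ->
    between (g a) (g b) (g (c j)) != between (g a) (g b) (g (c k)).
  move=> j3 k3 jk; have := S j k j3 k3 jk.
  have := S k j k3 j3; rewrite eq_sym => /(_ jk).
  have := gc j k j3 k3 jk; have := gac j; have := gac k.
  have := gbc j; have := gbc k; move: gab; rewrite /between.
  move: (g a) (g b) (g (c j)) (g (c k)) => x y u v; lia.
(* Pigeonhole: three vertices cannot lie on pairwise different sides when there are only two
   sides. *)
move: (side 0 1 isT isT isT) (side 0 2 isT isT isT) (side 1 2 isT isT isT).
by do 3!case: between.
Qed.

End Noncrossing.

(** * Cliques, and invariance under equality of edge sets *)

Lemma clique_topological_minor n (V : finType) (G : sgraph V) (f : 'I_n -> V) :
  (forall i j, i != j -> G (f i) (f j)) -> topological_minor (complete n) G.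
Proof.
move=> Gf; exists f, (fun _ _ => [::]); split=> // [i j fij|x y xy].
  by apply/eqP; apply: contraT => /Gf; rewrite fij adj_irrefl.
by rewrite /= Gf.
Qed.

Lemma eq_set2 (T : finType) (x y u v : T) :
  ([set x; y] == [set u; v]) = (x == u) && (y == v) || (x == v) && (y == u).
Proof.
apply/eqP/idP => [/setP E|/orP[]/andP[/eqP-> /eqP->]]; [|by []|exact: setUC].
have := E x; have := E y; have := E u; have := E v.
rewrite !inE !eqxx ?orbT /= ![v == _]eq_sym ![u == _]eq_sym.
by do 4![case: eqP => //= _].
Qed.

Lemma edgesP (V : finType) (G : sgraph V) (e : {set V}) :
  reflect (exists2 uv : V * V, G uv.1 uv.2 & e = [set uv.1; uv.2])
    (e \in edges G).
Proof.
by apply: (iffP imsetP) => -[uv Guv ->]; exists uv; rewrite ?inE in Guv *.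
Qed.

Lemma in_edges (V : finType) (G : sgraph V) x y :
  ([set x; y] \in edges G) = G x y.
Proof.
apply/edgesP/idP => [[[u v] /= Guv /eqP]|]; last by exists (x, y).
by rewrite eq_set2 => /orP[]/andP[/eqP-> /eqP->] //; rewrite adj_sym.
Qed.

(** Graphs are records of functions and proofs, so equal edge sets do not directly make them equal;
    properties are transported instead. *)
Lemma topological_minor_edges (W V : finType) (H : sgraph W) (G G' : sgraph V) :
  edges G = edges G' -> topological_minor H G -> topological_minor H G'.
Proof.
move=> eqE [f [p [f_inj path_p rev_p fp pp]]].
exists f, p; split=> // x y /path_p[xy up]; split=> //.
by rewrite -(@eq_path _ G) // => u v; rewrite -!in_edges eqE.
Qed.

Lemma outerplanar_edges (V : finType) (G G' : sgraph V) :
  edges G = edges G' -> outerplanar G -> outerplanar G'.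
Proof.
by move=> eqE [K4 K23]; split=> /(topological_minor_edges (esym eqE)).
Qed.

(** * Edit distance after adding one edge *)

Section AddEdge.
Variables (V : finType) (G : sgraph V) (a b : V).
(** The conjunct [x != y] keeps the relation irreflexive even if [a = b]. *)
Let add_edge_adj : rel V :=
  [rel x y | G x y || (x != y) && ([set x; y] == [set a; b])].

Fact add_edge_sym : symmetric add_edge_adj.
Proof. by move=> x y; rewrite /add_edge_adj /= adj_sym setUC eq_sym. Qed.

Fact add_edge_irrefl : irreflexive add_edge_adj.
Proof. by move=> x; rewrite /add_edge_adj /= adj_irrefl eqxx. Qed.

Definition add_edge := SGraph add_edge_sym add_edge_irrefl.

Lemma edges_add_edge : a != b -> edges add_edge = [set a; b] |: edges G.
Proof.
move=> ab; apply/setP => e; rewrite in_setU1; apply/edgesP/idP.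
  case=> -[x y] /= /orP[Gxy ->|/andP[_ /eqP <-] ->]; last by rewrite eqxx.
  by rewrite in_edges Gxy orbT.
case/orP=> [/eqP->|/edgesP[uv Guv ->]].
  by exists (a, b) => //; apply/orP; right; rewrite ab eqxx.
by exists uv => //; apply/orP; left.
Qed.

Lemma edit_distance_add_edge : a != b -> outerplanar G ->
  ~ outerplanar add_edge -> edit_distance outerplanar add_edge 1.
Proof.
(* The edge is new, so the symmetric difference with [G] has exactly one element; distance 0 would
   give an outerplanar graph the edges of [add_edge]. *)
move=> ab opG nopG; have Gab : ~~ G a b.
  apply/negP => Gab; apply: nopG; apply: outerplanar_edges opG.
  by rewrite edges_add_edge //; apply/esym/setUidPr; rewrite sub1set in_edges.
split=> [|k [G' [opG' ->]]].
  exists G; split=> //; rewrite edges_add_edge //.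
  rewrite setDUl setDv setU0 setDUr setDv setI0 set0U.
  suff -> : [set [set a; b]] :\: edges G = [set [set a; b]] by rewrite cards1.
  by apply/setDidPl; rewrite disjoints1 in_edges.
rewrite lt0n cards_eq0 setU_eq0 !setD_eq0 -eqEsubset; apply/eqP => eqE.
by apply: nopG; apply: outerplanar_edges opG'.
Qed.

End AddEdge.

(** * Existence of the edge-brittleness *)

Lemma ex_minimum (P : nat -> Prop) m : P m -> exists k, is_minimum P k.
Proof.
elim/ltn_ind: m => m IHm Pm.
have [[k [Pk km]]|nP] := classic (exists k, P k /\ k < m); first exact: IHm Pk.
exists m; split=> // k Pk; rewrite leqNgt; apply/negP => km.
by apply: nP; exists k.
Qed.

Lemma ex_edge_brittleness (V : finType) (G : sgraph V) :
  exists m, edge_brittleness outerplanar G m.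
Proof.
pose P := [set [set x] | x : V]; apply: (@ex_minimum _ #|cross_edges G P|).
exists P; split=> // [|_ /imsetP[x _ ->]].
  apply/and3P; split; last by apply/imsetP => -[x _ /setP/(_ x)]; rewrite !inE eqxx.
    apply/eqP/setP => x; rewrite inE; apply/bigcupP; exists [set x]; rewrite ?inE //.
    exact: imset_f.
  apply/trivIsetP => _ _ /imsetP[x _ ->] /imsetP[y _ ->] xy.
  by rewrite disjoints1 inE; apply: contra xy => /eqP->.
(* A part of the partition into singletons induces an edgeless graph, for which any injective
   placement is noncrossing. *)
apply: (@noncrossing_outerplanar _ _ enum_rank).
  by move=> u v /val_inj /enum_rank_inj.
move=> u v w z; have -> : u = v; last by rewrite adj_irrefl.
by apply: val_inj; have /set1P-> := valP u; have /set1P-> := valP v.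
Qed.

(** * The dyadic graph and its outerplanarity *)

Definition dyadic_arc k (x y : nat) :=
  [exists i : 'I_k.+1, (2 ^ i %| x) && (y == x + 2 ^ i)].

Section Dyadic.
Variable k : nat.
Let dyadic_adj : rel 'I_(2 ^ k).+1 :=
  [rel x y | dyadic_arc k (val x) (val y) || dyadic_arc k (val y) (val x)].

Lemma dyadic_arc_lt x y : dyadic_arc k x y -> x < y.
Proof.
by case/existsP=> i /andP[_ /eqP->]; rewrite -[X in X < _]addn0 ltn_add2l expn_gt0.
Qed.

Fact dyadic_sym : symmetric dyadic_adj.
Proof. by move=> x y; exact: orbC. Qed.

Fact dyadic_irrefl : irreflexive dyadic_adj.
Proof. by move=> x; apply/negP => /orP[]/dyadic_arc_lt; rewrite ltnn. Qed.

Definition dyadic := SGraph dyadic_sym dyadic_irrefl.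

Lemma dvdn_between d x z : d %| x -> d %| z -> ~~ (x < z < x + d).
Proof.
move=> /dvdnP[p ->] /dvdnP[q ->]; apply/negP => /andP[].
rewrite -mulSnr !ltn_mul2r => /andP[_ pq] /andP[_].
by rewrite ltnS leqNgt pq.
Qed.

(** If two arcs interleaved, an end of the longer one would be a multiple of the shorter length
    strictly between two consecutive such multiples. *)
Lemma dyadic_arc_crossing x y u v :
  dyadic_arc k x y -> dyadic_arc k u v -> ~~ [&& x < u, u < y & y < v].
Proof.
move=> /existsP[i /andP[xi /eqP->]] /existsP[j /andP[uj /eqP->]].
apply/negP => /and3P[xu uy yv]; have [ij|/ltnW ji] := leqP i j.
  have /negP[] := dvdn_between xi (dvdn_trans (dvdn_exp2l 2 ij) uj).
  by rewrite xu uy.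
have xij : 2 ^ j %| x + 2 ^ i by rewrite dvdn_add ?(dvdn_trans _ xi) ?dvdn_exp2l.
by have /negP[] := dvdn_between uj xij; rewrite uy yv.
Qed.

Lemma dyadic_noncrossing : noncrossing dyadic val.
Proof.
move=> x y u v xy uv; rewrite !inE -!(inj_eq val_inj) /=.
have h (a b c d : nat) : dyadic_arc k a b -> dyadic_arc k c d ->
  [/\ a < b, c < d, ~~ [&& a < c, c < b & b < d] & ~~ [&& c < a, a < d & d < b]].
  by move=> ab cd; split; first [exact: dyadic_arc_lt | exact: dyadic_arc_crossing].
rewrite /between.
case/orP: xy => xy; case/orP: uv => uv; have /= := h _ _ _ _ xy uv;
  move: (nat_of_ord x) (nat_of_ord y) (nat_of_ord u) (nat_of_ord v);
  move=> a b c d [? ? ? ?] ? ?; lia.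
Qed.

Lemma dyadic_outerplanar : outerplanar dyadic.
Proof. exact: noncrossing_outerplanar val_inj dyadic_noncrossing. Qed.

(** The bound keeps both arguments of [inord] in range and also forces [i <= k]. *)
Lemma dyadic_adjE i q : q.+1 * 2 ^ i <= 2 ^ k ->
  dyadic (inord (q * 2 ^ i)) (inord (q.+1 * 2 ^ i)).
Proof.
move=> le_k; have ik : i <= k.
  by rewrite -(@leq_exp2l 2) //; apply: leq_trans le_k; rewrite leq_pmull.
apply/orP; left; apply/existsP; exists (Ordinal (ik : i < k.+1)) => /=.
have le_k' : q * 2 ^ i <= 2 ^ k.
  by apply: leq_trans le_k; rewrite leq_mul2r leqnSn orbT.
by rewrite !inordK ?ltnS // dvdn_mull // mulSnr eqxx.
Qed.

End Dyadic.

(** * Edges cut at every dyadic scale *)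

Lemma dyadic_separation (T : eqType) (c : nat -> T) i j q : j <= i ->
  c (q * 2 ^ i) != c (q.+1 * 2 ^ i) ->
  exists2 r, r.+1 * 2 ^ j <= q.+1 * 2 ^ i & c (r * 2 ^ j) != c (r.+1 * 2 ^ j).
Proof.
elim: i q => [|i IHi] q; first by rewrite leqn0 => /eqP-> ?; exists q.
rewrite leq_eqVlt => /orP[/eqP->|]; first by exists q.
rewrite ltnS => ji; rewrite expnS !mulnA => sep.
(* The midpoint [(q * 2).+1 * 2 ^ i] differs in colour from at least one end, so one of the two
   halves is again separated. *)
have [eqc|neqc] := eqVneq (c (q * 2 * 2 ^ i)) (c ((q * 2).+1 * 2 ^ i)).
  have [|r r_le r_sep] := IHi (q * 2).+1 ji; first by rewrite -eqc; exact: sep.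
  by exists r.
have [r r_le r_sep] := IHi _ ji neqc; exists r => //.
by apply: (leq_trans r_le); rewrite leq_mul2r mulSn leqnSn orbT.
Qed.

Section DyadicK4.
Variable l : nat.
Let M := 2 ^ l.
Let a : 'I_(2 ^ l.+2).+1 := inord M.
Let b : 'I_(2 ^ l.+2).+1 := inord (4 * M).
Let f (i : 'I_4) : 'I_(2 ^ l.+2).+1 := inord (nth 0 [:: 0; 1; 2; 4] i * M).

Definition dyadicK4 := add_edge (dyadic l.+2) a b.

Let size_M : 2 ^ l.+2 = 4 * M.
Proof. by rewrite !expnS mulnA. Qed.

Let M_gt0 : 0 < M.
Proof. by rewrite expn_gt0. Qed.

Let val_inord q : q <= 4 -> val (inord (q * M) : 'I_(2 ^ l.+2).+1) = q * M.
Proof. by move=> q4; rewrite /= inordK // ltnS size_M leq_mul2r q4 orbT. Qed.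

Lemma chord_neq : a != b.
Proof.
rewrite -val_eqE /a /b val_inord // -[M in inord M]mul1n val_inord //.
by rewrite eqn_mul2r -leqn0 leqNgt M_gt0.
Qed.

(** Among the pairs from 0, [M], [2M], [4M], only [M] and [4M] are not joined by a dyadic arc, and
    the added edge joins them. *)
Lemma dyadicK4_clique i j : i != j -> dyadicK4 (f i) (f j).
Proof.
wlog ij : i j / i < j.
  move=> W neq_ij; have [/W->//|ji|/val_inj eq_ij] := ltngtP i j.
    by rewrite adj_sym W // eq_sym.
  by rewrite eq_ij eqxx in neq_ij.
move=> _.
have D m q : q.+1 * 2 ^ m <= 4 ->
   dyadicK4 (inord (q * 2 ^ m * M)) (inord (q.+1 * 2 ^ m * M)).
  move=> q4; apply/orP; left; rewrite -!mulnA -!expnD.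
  by apply: dyadic_adjE; rewrite expnD mulnA size_M leq_mul2r q4 orbT.
have ab : dyadicK4 (inord (1 * M)) (inord (4 * M)).
  by apply/orP; right; rewrite mul1n chord_neq eqxx.
move: ij; rewrite /f.
(* The hypothesis [ab] settles the pair (1, 3); the other five remain in lexicographic order. *)
case: i => -[|[|[|[|]]]] //= _; case: j => -[|[|[|[|]]]] //= _ _.
- exact: (D 0 0).
- exact: (D 1 0).
- exact: (D 2 0).
- exact: (D 0 1).
- exact: (D 1 1).
Qed.

Lemma dyadicK4_nonouterplanar : ~ outerplanar dyadicK4.
Proof. by case=> + _; apply; exact: clique_topological_minor dyadicK4_clique. Qed.

Lemma dyadicK4_cut (P : {set {set 'I_(2 ^ l.+2).+1}}) :
  partition P [set: _] -> (forall A, A \in P -> outerplanar (induced dyadicK4 A)) ->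
  l < #|cross_edges dyadicK4 P|.
Proof.
move=> partP outP.
(* Outside the vertex range [inord] takes a default value, but the multiples used below are all at
   most [4M]. *)
pose c q := pblock P (inord q).
have [q q4 sep] : exists2 q, q < 4 & c (q * M) != c (q.+1 * M).
  have [[q sep]|nsep] := pickP [pred q : 'I_4 | c (q * M) != c (q.+1 * M)].
    by move=> ?; exists q.
  have c0 q : q <= 4 -> c (q * M) = c 0.
    elim: q => [|q IHq q4]; first by rewrite mul0n.
    rewrite -(IHq (ltnW q4)); have /negbFE/eqP := nsep (Ordinal q4).
    by move->.
  have in_c0 i : f i \in c 0.
    rewrite -(c0 (nth 0 [:: 0; 1; 2; 4] i)).
      by rewrite mem_pblock (cover_partition partP).
    by case: i => -[|[|[|[|]]]].
  have [] := outP (c 0); first by rewrite pblock_mem // (cover_partition partP).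
  case; apply: (@clique_topological_minor _ _ _ (fun i => Sub (f i) (in_c0 i))).
  exact: dyadicK4_clique.
(* The length [2 ^ j] is recorded with the cut edge, so that edges chosen for different [j] can be
   told apart. *)
have edge (j : 'I_l.+1) : exists e : {set 'I_(2 ^ l.+2).+1},
    e \in cross_edges dyadicK4 P /\
    exists2 x, x + 2 ^ j <= 2 ^ l.+2 & e = [set inord x; inord (x + 2 ^ j)].
  have [r r_le r_sep] := dyadic_separation (ltn_ord j : j <= l) sep.
  have r_le4 : r.+1 * 2 ^ j <= 2 ^ l.+2.
    by rewrite size_M (leq_trans r_le) // leq_mul2r q4 orbT.
  rewrite mulSnr in r_sep r_le4.
  exists [set inord (r * 2 ^ j); inord (r * 2 ^ j + 2 ^ j)]; split.
    apply/imsetP; exists (inord (r * 2 ^ j), inord (r * 2 ^ j + 2 ^ j)) => //.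
    rewrite inE /= r_sep andbT; apply/orP; left; rewrite -mulSnr.
    by apply: dyadic_adjE; rewrite mulSnr.
  by exists (r * 2 ^ j).
have [e e_spec] := fin_all_exists edge.
have e_inj : injective e.
  move=> i j /eqP; have [_ [x x_le ->]] := e_spec i.
  have [_ [y y_le ->]] := e_spec j.
  have x_le' := leq_trans (leq_addr _ _) x_le.
  have y_le' := leq_trans (leq_addr _ _) y_le.
  (* Equal unordered pairs could also match with ends swapped; positive lengths exclude this,
     leaving equal lengths. *)
  rewrite eq_set2 -!val_eqE /= !inordK ?ltnS // => eqs.
  apply: val_inj; apply: (@expnI 2) => //.
  have: 0 < 2 ^ i by rewrite expn_gt0.
  have: 0 < 2 ^ j by rewrite expn_gt0.
  move: eqs; move: (2 ^ i) (2 ^ j) => p r; lia.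
rewrite -[X in X <= _]card_ord -(card_imset _ e_inj); apply: subset_leq_card.
by apply/subsetP=> _ /imsetP[j _ ->]; have [] := e_spec j.
Qed.

End DyadicK4.

Theorem proposition1p6 :
  forall l : nat, 0 < l ->
  exists (V : finType) (G : sgraph V),
    edit_distance outerplanar G 1 /\
    exists m : nat, edge_brittleness outerplanar G m /\ l <= m.
Proof.
move=> l _; exists _, (dyadicK4 l); split.
  apply: edit_distance_add_edge.
  - exact: chord_neq.
  - exact: dyadic_outerplanar.
  - exact: dyadicK4_nonouterplanar.
have [m [[P [partP outP eq_m]] min_m]] := ex_edge_brittleness (dyadicK4 l).
exists m; split; first by split=> //; exists P.
by rewrite eq_m ltnW // dyadicK4_cut.
Qed.
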